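(* Let $\mathcal{A}=((V_i)_{1\le i\le n},E)$ be an $n$-player arena (with a possibly infinite vertex set $V$), let $T_1,\dots,T_n\subseteq V$ and let $\mathcal{G}=(\mathcal{A},(\mathsf{coB\ddot{u}chi}(T_i))_{1\le i\le n})$ be the associated co-Büchi game. Let $\sigma'$ be a Nash equilibrium from a vertex $v_0$ in $\mathcal{G}$. Then there exists a finite-memory Nash equilibrium $\sigma$ from $v_0$ in $\mathcal{G}$ such that $\mathsf{SatPl}(\mathsf{Out}(\sigma',v_0))\subseteq\mathsf{SatPl}(\mathsf{Out}(\sigma,v_0))$. If $\mathcal{A}$ is finite, a memory size of at most $|V|+2n$ suffices (i.e., $\sigma$ can be chosen such that each of its strategies has memory size at most $|V|+2n$).
   Context: Arenas. An $n$-player arena ($n\ge 1$) is $\mathcal{A}=((V_i)_{1\le i\le n},E)$ where $V$ is a (possibly infinite) set of vertices, $(V_i)_{1\le i\le n}$ is a partition of $V$ (parts may be empty; $V_i$ is the set of vertices controlled by player $P_i$), $E\subseteq V\times V$, and every vertex has at least one $E$-successor. A play is an infinite sequence $v_0v_1\ldots$ with $(v_\ell,v_{\ell+1})\in E$ for all $\ell\in\mathbb{N}$; a history is a finite non-empty prefix of a play. Strategies. A strategy of $P_i$ is a function $\sigma_i$ mapping each history $h$ ending in $V_i$ to an $E$-successor of the last vertex of $h$. A strategy profile is a tuple $\sigma=(\sigma_i)_{1\le i\le n}$ with one strategy per player. A play $v_0v_1\ldots$ is consistent with $\sigma_i$ if $v_\ell\in V_i$ implies $v_{\ell+1}=\sigma_i(v_0\ldots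 v_\ell)$ for all $\ell$. $\mathsf{Out}(\sigma,v_0)$ is the unique play from $v_0$ consistent with all strategies of $\sigma$. Finite memory. A Mealy machine of $P_i$ is $(M,m_{\mathsf{init}},\mathsf{up},\mathsf{nxt}_i)$ with $M$ a finite set, $m_{\mathsf{init}}\in M$, $\mathsf{up}\colon M\times V\to M$ and $\mathsf{nxt}_i\colon M\times V_i\to V$. Let $\widehat{\mathsf{up}}(\varepsilon)=m_{\mathsf{init}}$ and $\widehat{\mathsf{up}}(wv)=\mathsf{up}(\widehat{\mathsf{up}}(w),v)$ for $w\in V^*$, $v\in V$. The machine induces the strategy $\sigma_i(h'v)=\mathsf{nxt}_i(\widehat{\mathsf{up}}(h'),v)$ for every history $h'v$ ending in $v\in V_i$ (with $h'\in V^*$ possibly empty). A strategy is finite-memory if it is induced by a Mealy machine, and has memory size at most $b$ if it is induced by some Mealy machine with $|M|\le b$. A strategy profile is finite-memory if all its strategies are. Objectives and equilibria. $\mathsf{coB\ddot{u}chi}(T)$ is the set of plays $v_0v_1\ldots$ with $v_\ell\in T$ for only finitely many $\ell$; the objective of $P_i$ in $\mathcal{G}$ is $\mathsf{coB\ddot{u}chi}(T_i)$. $\mathsf{SatPl}(\pi)=\{i\mid \pi\in\mathsf{coB\ddot{u}chi}(T_i)\}$. A strategy profile $\sigma$ is a Nash equilibrium from $v_0$ if no player whose objective is not satisfied by $\mathsf{Out}(\sigma,v_0)$ has a strategy such that, when this player alone replaces their strategy in $\sigma$ by it, the outcome from $v_0$ satisfies their objective. *)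

(* Defs.v *)
From mathcomp Require Import all_boot.
From mathcomp Require Import all_classical.

Set Implicit Arguments.
Unset Strict Implicit.
Unset Printing Implicit Defensive.

Local Open Scope classical_set_scope.

Record arena (n : nat) (V : Type) := Arena {
  ctrl : 'I_n -> set V;
  edge : V -> V -> Prop;
  ctrl_partition : forall v, exists! i, ctrl i v;
  edge_total : forall v, exists w, edge v w }.

Definition owner n V (A : arena n V) (v : V) : 'I_n :=
  projT1 (cid (ctrl_partition A v)).

Definition is_play n V (A : arena n V) (p : nat -> V) : Prop :=
  forall l, edge A (p l) (p l.+1).

Definition is_history n V (A : arena n V) (h : seq V) : Prop :=
  h <> [::] /\ exists2 p, is_play A p & h = mkseq p (size h).

(* The history [rcons h v] is passed as the two arguments [h] and [v]. The
   values at arguments that do not form a history ending in [ctrl A i] are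
   junk: nothing below depends on them. *)
Record strategy n V (A : arena n V) (i : 'I_n) := Strategy {
  strategy_fun :> seq V -> V -> V;
  strategy_edge : forall h v, is_history A (rcons h v) -> ctrl A i v ->
    edge A v (strategy_fun h v) }.

Definition profile n V (A : arena n V) := forall i, strategy A i.

Definition consistent n V (A : arena n V) i (s : strategy A i) (p : nat -> V) :=
  forall l, ctrl A i (p l) -> p l.+1 = s (mkseq p l) (p l).

(* The iterated pair is [(p_0 ... p_(l-1), p_l)]. That this is the unique
   consistent play from [v0] is [OutP] below. *)
Definition Out n V (A : arena n V) (s : profile A) (v0 : V) (l : nat) : V :=
  (iter l (fun hv => (rcons hv.1 hv.2, s (owner A hv.2) hv.1 hv.2))
     ([::], v0)).2.

(* [mealy_next] is only ever used at vertices of the player who owns the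
   machine; its values elsewhere are junk. *)
Record mealy (V : Type) := Mealy {
  mealy_state : finType;
  mealy_init : mealy_state;
  mealy_up : mealy_state -> V -> mealy_state;
  mealy_next : mealy_state -> V -> V }.

Definition mealy_run V (M : mealy V) (w : seq V) : mealy_state M :=
  foldl (@mealy_up V M) (mealy_init M) w.

Definition induces n V (A : arena n V) i (M : mealy V) (s : strategy A i) :=
  forall h v, is_history A (rcons h v) -> ctrl A i v ->
    s h v = mealy_next (mealy_run M h) v.

Definition finite_memory n V (A : arena n V) i (s : strategy A i) : Prop :=
  exists M : mealy V, induces M s.

Definition memory_at_most n V (A : arena n V) i (s : strategy A i) (b : nat) :=
  exists2 M : mealy V, (#|mealy_state M| <= b)%N & induces M s.

Definition finite_memory_profile n V (A : arena n V) (s : profile A) : Prop :=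
  forall i, finite_memory (s i).

Definition coBuchi n V (A : arena n V) (T : set V) : set (nat -> V) :=
  [set p | is_play A p /\ finite_set [set l | T (p l)]].

Definition SatPl n V (A : arena n V) (T : 'I_n -> set V) (p : nat -> V) :
  set 'I_n := [set i | coBuchi A (T i) p].

Definition nash n V (A : arena n V) (T : 'I_n -> set V) (s : profile A)
    (v0 : V) : Prop :=
  forall i, ~ SatPl A T (Out s v0) i ->
    ~ exists t : strategy A i, coBuchi A (T i) (Out (dfwith s i t) v0).

Lemma ownerP n V (A : arena n V) v i : ctrl A i v <-> owner A v = i.
Proof.
rewrite /owner; case: cid => j [jv juniq] /=; split; first exact: juniq.
by move=> <-.
Qed.

Lemma history_path n V (A : arena n V) (p : nat -> V) l :
  (forall k, (k < l)%N -> edge A (p k) (p k.+1)) ->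
  is_history A (rcons (mkseq p l) (p l)).
Proof.
move=> pE; have [f fE] := choice (edge_total A).
split; first by case: (mkseq p l).
pose q k := if (k <= l)%N then p k else iter (k - l) f (p l).
exists q => [k|].
  rewrite /q; have [kl|lk|->] := ltngtP k l.
  - exact: pE.
  - by rewrite subSn ?(ltnW lk)//= .
  - by rewrite subSnn /=.
rewrite size_rcons size_mkseq -mkseqS; apply/eq_in_map => k.
by rewrite mem_iota add0n ltnS /q => /andP[_ ->].
Qed.

Lemma OutP n V (A : arena n V) (s : profile A) (v0 : V) (p : nat -> V) :
  [/\ is_play A p, p 0%N = v0 & forall i, consistent (s i) p] <->
  p = Out s v0.
Proof.
pose st l := iter l (fun hv => (rcons hv.1 hv.2, s (owner A hv.2) hv.1 hv.2))
  ([::], v0).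
have OutE l : Out s v0 l = (st l).2 by [].
have stE l : (st l).1 = mkseq (Out s v0) l.
  by elim: l => // l IH; rewrite mkseqS -IH.
have OutS l : Out s v0 l.+1 =
    s (owner A (Out s v0 l)) (mkseq (Out s v0) l) (Out s v0 l).
  by rewrite -stE.
split=> [[_ p0 pc]|->].
  apply/funext => l; have [m] := ubnP l; elim: m l => // m IH [_|l lm].
    by rewrite p0.
  rewrite OutS -(IH l)// (pc (owner A (p l))); last exact/ownerP.
  congr (strategy_fun _ _ _); apply/eq_in_map => k; rewrite mem_iota add0n.
  by move=> /andP[_ kl]; apply: IH; apply: ltn_trans kl _.
split=> [l||i l /ownerP <-]; [|by []|exact: OutS].
have [m] := ubnP l; elim: m l => // m IH l lm; rewrite OutS.
apply: strategy_edge; last exact/ownerP.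
by apply: history_path => k kl; apply: IH; apply: leq_trans kl _.
Qed.

(* Main.v *)
(* If player i cannot profitably deviate from the outcome of the given
   equilibrium, all vertices of that outcome lie in a set Y_i from which the
   other players can visit T_i infinitely often with one memoryless strategy.
   Among the plays from v0 that satisfy at least the objectives of the
   outcome and remain in Y_i for every player i that loses on them, choose a play
   p that satisfies a maximal set S of objectives. A tail of p avoids T_i for
   all i in S; let Q be its set of vertices. By maximality, every play from v0 on
   vertices of p that ends up in Q satisfies exactly S, so a deviation by a loser
   that stays in Q is harmless and need not be detected. It thus suffices to
   follow a simple path into Q, to move within Q by a memoryless rule, and to
   punish whoever leaves this pattern. If the simple path has N + 1 vertices, this
   takes N + 1 states for the path, n states for the owner of the last vertex in
   Q and n punishing states. *)
Require Import Defs.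
From mathcomp Require Import all_boot.
From mathcomp Require Import all_classical.

Local Open Scope classical_set_scope.
Local Open Scope card_scope.

Lemma finite_set_natP (A : set nat) :
  finite_set A <-> exists N, forall k, A k -> k < N.
Proof.
split=> [/finite_seqP[s ->]|[N AN]]; last exact: sub_finite_set (finite_II N).
by exists (\max_(k <- s) k).+1 => k /= ks; rewrite ltnS; exact: leq_bigmax_seq.
Qed.

(** * Attractors and positional strategies *)

(* [O] is the set of the vertices of the adversary, who wants to avoid [G]. *)
Inductive attractor (V : Type) (E : V -> V -> Prop) (O G : set V) : V -> Prop :=
| attractor_base v : G v -> attractor V E O G v
| attractor_adversary v : O v -> (forall w, E v w -> attractor V E O G w) ->
    attractor V E O G v
| attractor_opponent v w : ~ O v -> E v w -> attractor V E O G w ->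
    attractor V E O G v.

(** As [f] is an arbitrary function, the opponents' clause must itself ask that its move is an edge;
    Zorn's lemma can then range over all of [V -> V]. *)
Inductive attracted_by (V : Type) (E : V -> V -> Prop) (O G : set V)
    (f : V -> V) : V -> Prop :=
| attracted_base v : G v -> attracted_by V E O G f v
| attracted_adversary v : O v ->
    (forall w, E v w -> attracted_by V E O G f w) -> attracted_by V E O G f v
| attracted_opponent v : ~ O v -> E v (f v) ->
    attracted_by V E O G f (f v) -> attracted_by V E O G f v.

Lemma attracted_by_mono (V : Type) (E : V -> V -> Prop) (O G : set V)
    (f f' : V -> V) :
  (forall v, attracted_by V E O G f v -> f v = f' v) ->
  forall v, attracted_by V E O G f v -> attracted_by V E O G f' v.
Proof.
move=> ff' v; elim => {v} [v Gv|v Ov _ IH|v Ov Ev av IH].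
- exact: attracted_base.
- exact: attracted_adversary.
- have fv : f v = f' v by apply/ff'/attracted_opponent.
  by apply: attracted_opponent => //; rewrite -fv.
Qed.

(* Zorn's lemma on moves [f], where [f'] extends [f] if it agrees with [f] on
   the vertices that [f] already attracts. *)
Lemma positional_attractor (V : Type) (E : V -> V -> Prop) (O G : set V) :
  exists f : V -> V, attractor V E O G `<=` attracted_by V E O G f.
Proof.
pose W := attracted_by V E O G.
pose ext f f' := `[< forall v, W f v -> f v = f' v >].
have extW f f' v : ext f f' -> W f v -> W f' v.
  by move=> /asboolP ff'; exact: attracted_by_mono.
have [||C Ctot|f fmax] := @ZL_preorder _ (@id V) ext.
- by move=> f; apply/asboolP.
- move=> g f h fg gh; apply/asboolP => v Wfv.
  rewrite ((asboolP _ fg) _ Wfv); apply: (asboolP _ gh).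
  exact: (extW _ _ _ fg).
(* Members of a chain agree wherever they attract, so their moves there glue to an upper bound. *)
- have /choice[h hP] : forall v, exists w, forall f, C f -> W f v -> f v = w.
    move=> v; have [[f [Cf fv]]|no] := pselect (exists f, C f /\ W f v).
      exists (f v) => g Cg gv; case: (Ctot _ _ Cf Cg) => /asboolP fg.
        exact/esym/fg.
      exact: fg.
    by exists v => f Cf fv; case: no; exists f.
  by exists h => f Cf; apply/asboolP => v; exact: hP.
exists f => v; elim => {v} [v Gv|v Ov _ IH|v w Ov vw _ fw].
- exact: attracted_base.
- exact: attracted_adversary.
- apply: contrapT => nfv.
  (* Redirecting [f] only at [v], which it does not attract, extends it; by maximality [f] then
     attracts [v] after all. *)
  pose f' x := if `[< x = v >] then w else f x.
  have ff' : ext f f'.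
    apply/asboolP => x Wx; rewrite /f'; case: asboolP => // xv.
    by case: nfv; rewrite -xv.
  apply: nfv; apply: (extW _ _ _ (fmax _ ff')).
  have f'v : f' v = w by rewrite /f'; case: asboolP.
  by apply: attracted_opponent; rewrite ?f'v//; apply: (extW _ _ _ ff').
Qed.

(** Moves are prescribed only outside [G]; the move at a vertex of [G] stays free for returning to
    the attractor. *)
Lemma attracted_by_visits (V : Type) (E : V -> V -> Prop) (O G : set V)
    (f : V -> V) (q : nat -> V) (l : nat) :
  (forall k, l <= k -> E (q k) (q k.+1)) ->
  (forall k, l <= k -> ~ O (q k) -> ~ G (q k) -> E (q k) (f (q k)) ->
     q k.+1 = f (q k)) ->
  attracted_by V E O G f (q l) -> exists2 k, l <= k & G (q k).
Proof.
move=> qE qf; move qlE : (q l) => v fv.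
elim: fv l qE qf qlE => {v} [v Gv|v Ov _ IH|v Ov Ev fv IH] l qE qf qlE.
- by exists l => //; rewrite qlE.
- have [||||k lk Gk] := IH (q l.+1) _ l.+1; rewrite -?qlE//; first exact: qE.
  + by move=> k lk; apply: qE; exact: ltnW.
  + by move=> k lk; apply: qf; exact: ltnW.
  + by exists k => //; exact: ltnW.
- have [Gv|nGv] := pselect (G v); first by exists l => //; rewrite qlE.
  have [|||k lk Gk] := IH l.+1.
  + by move=> k lk; apply: qE; exact: ltnW.
  + by move=> k lk; apply: qf; exact: ltnW.
  + by rewrite qf ?qlE.
  + by exists k => //; exact: ltnW.
Qed.

(** * Deviations and extensions of plays *)

Lemma deviation_outcome (n : nat) (V : Type) (A : arena n V) (s : profile A)
    (i : 'I_n) (q : nat -> V) :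
  is_play A q -> (forall j, j != i -> consistent (s j) q) ->
  exists t : strategy A i, Out (dfwith s i t) (q 0) = q.
Proof.
move=> qE qs; have [g gE] := choice (edge_total A).
(* The deviator replays [q] on its prefixes and moves arbitrarily elsewhere. *)
pose f h v := if `[< rcons h v = mkseq q (size h).+1 >] then q (size h).+1
              else g v.
have fE h v : is_history A (rcons h v) -> ctrl A i v -> edge A v (f h v).
  move=> _ _; rewrite /f; case: asboolP => //.
  by rewrite mkseqS => /rcons_inj[_ ->].
exists (Strategy fE); apply/esym/OutP; split=> // j.
have [->|ji] := eqVneq j i; last by rewrite dfwithout 1?eq_sym//; exact: qs.
move=> l _; rewrite dfwithin /= /f size_mkseq.
by case: asboolP => // -[]; rewrite mkseqS.
Qed.

Lemma extend_play (n : nat) (V : Type) (A : arena n V) (f : seq V -> V -> V)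
    (p : nat -> V) (l : nat) :
  is_play A p -> (forall h v, is_history A (rcons h v) -> edge A v (f h v)) ->
  exists q, [/\ is_play A q, forall k, k <= l -> q k = p k &
    forall k, l <= k -> q k.+1 = f (mkseq q k) (q k)].
Proof.
move=> pE fE.
pose next h v := if size h < l then p (size h).+1 else f h v.
pose st k := iter k (fun hv => (rcons hv.1 hv.2, next hv.1 hv.2)) ([::], p 0).
pose q k := (st k).2.
have stE k : (st k).1 = mkseq q k by elim: k => // k IH; rewrite mkseqS -IH.
have qS k : q k.+1 = if k < l then p k.+1 else f (mkseq q k) (q k).
  by rewrite {1}/q /= /next -/(st k) stE size_mkseq.
have qp k : k <= l -> q k = p k by case: k => // k kl; rewrite qS kl.
exists q; split=> //; last by move=> k; rewrite leqNgt qS => /negbTE ->.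
move=> k; have [m] := ubnP k; elim: m k => // m IH k km.
have [kl|lk] := ltnP k l; first by rewrite !qp ?(ltnW kl).
rewrite qS ltnNge lk; apply/fE/history_path => j jk.
by apply: IH; exact: leq_trans jk _.
Qed.

(** * Memoryless punishment of one player *)

(* Player [i] can still win after [p_0 ... p_l] if the others play by [s]. *)
Definition escapes (n : nat) (V : Type) (A : arena n V) (s : profile A)
    (i : 'I_n) (T : set V) (p : nat -> V) (l : nat) : Prop :=
  exists q, [/\ coBuchi A T q, forall k, k <= l -> q k = p k &
    forall k j, l <= k -> j != i -> ctrl A j (q k) ->
      q k.+1 = s j (mkseq q k) (q k)].

(** Between [l] and [m] the others follow their strategies along [q], so a play escaping after [m]
    already escapes after [l]. *)
Lemma escapes_anti (n : nat) (V : Type) (A : arena n V) (s : profile A)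
    (i : 'I_n) (T : set V) (p q : nat -> V) (l m : nat) :
  l <= m -> (forall k, k <= l -> q k = p k) ->
  (forall k j, l <= k < m -> j != i -> ctrl A j (q k) ->
     q k.+1 = s j (mkseq q k) (q k)) ->
  escapes n V A s i T q m -> escapes n V A s i T p l.
Proof.
move=> lm qp qs [r [rT rq rs]]; exists r; split=> // [k kl|k j lk ji].
  by rewrite rq ?qp// (leq_trans kl).
have [mk|km] := leqP m k; first exact: rs.
rewrite !rq ?(ltnW km)// => jq; rewrite (qs k j) ?lk//.
congr (strategy_fun _ _ _); apply/eq_in_map => x; rewrite mem_iota add0n.
by move=> /andP[_ xk]; rewrite rq// ltnW// (ltn_trans xk).
Qed.

(** The controllable predecessor of [Z] for the opponents of [O]. *)
Definition forced_next (V : Type) (E : V -> V -> Prop) (O Z : set V) : set V :=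
  [set v | (O v -> forall w, E v w -> Z w) /\
           (~ O v -> exists2 w, E v w & Z w)].

(* Outside the attractor, the adversary can avoid it forever; as no vertex of
   [Z] is followed by an escape, the play built this way stays in [Z], hence
   never meets [T], and is itself an escape. *)
Lemma stuck_in_attractor (n : nat) (V : Type) (A : arena n V) (s : profile A)
    (i : 'I_n) (T : set V) (Z := [set v | exists p l, [/\ is_play A p, p l = v
      & ~ escapes n V A s i T p l]]) :
  Z `<=` attractor V (edge A) (ctrl A i)
           (T `&` forced_next V (edge A) (ctrl A i) Z).
Proof.
move=> v [p [l [pE plv esc]]]; apply: contrapT => nBv.
set B := attractor _ _ _ _ in nBv.
have [g gE] := choice (edge_total A).
have /choice[a aP] : forall v, exists w, edge A v w /\
    (ctrl A i v -> ~ B v -> ~ B w).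
  move=> u; have [[w uw Bw]|no] := pselect (exists2 w, edge A u w & ~ B w).
    by exists w.
  exists (g u); split=> // iu nBu; case: nBu; apply: attractor_adversary => //.
  by move=> w uw; apply: contrapT => Bw; case: no; exists w.
pose f h u := if owner A u == i then a u else s (owner A u) h u.
have [|q [qE qp qf]] := @extend_play _ _ A f p l pE.
  move=> h u hu; rewrite /f; case: eqP => _; first by case: (aP u).
  by apply: strategy_edge => //; exact/ownerP.
have qs k j : l <= k -> j != i -> ctrl A j (q k) ->
    q k.+1 = s j (mkseq q k) (q k).
  by move=> lk ji /ownerP jk; rewrite qf// /f jk (negbTE ji).
have qB k : l <= k -> ~ B (q k).
  elim: k => [|k IH]; first by rewrite leqn0 => /eqP l0; rewrite -l0 qp// plv.
  rewrite leq_eqVlt => /orP[/eqP <-|]; first by rewrite qp// plv.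
  rewrite ltnS => lk; have nB := IH lk.
  rewrite qf// /f; case: eqP => [/ownerP ik|ik].
    by case: (aP (q k)) => _; exact.
  move=> Bk; apply: nB; apply: attractor_opponent Bk; first by move=> /ownerP.
  have := qE k; rewrite qf// /f; by move/eqP/negbTE: ik => ->.
have qesc k : l <= k -> ~ escapes n V A s i T q k.
  move=> lk e; apply: esc; apply: escapes_anti e => // x j /andP[lx _].
  exact: qs.
(* A visit to [T] would lie in the attractor's target: the opponents' move stays in [Z] by [qesc],
   and so does every move [w] of the adversary, since an escape after the detour [r] through [w]
   would be one before it. *)
have qT k : l <= k -> ~ T (q k).
  move=> lk Tk; apply: (qB k lk); apply: attractor_base; split=> //.
  split=> ik; last first.
    exists (q k.+1); first exact: qE.
    by exists q, k.+1; split=> //; apply: qesc; exact: leqW.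
  move=> w kw; apply: contrapT => nZw; apply: (qesc k lk).
  have [|r [rE rq rf]] := @extend_play _ _ A
      (fun h u => if size h == k then (if `[< edge A u w >] then w else g u)
                  else g u) q k qE.
    by move=> h u _; case: eqP => // _; case: asboolP.
  have rk : r k.+1 = w.
    by rewrite rf// size_mkseq eqxx rq//; case: asboolP.
  apply: (@escapes_anti _ _ _ _ _ _ _ r _ k.+1) => //.
    move=> x j /andP[kx]; rewrite ltnS => xk ji.
    have -> : x = k by apply/eqP; rewrite eqn_leq xk.
    by rewrite rq// => /ownerP jk; move/ownerP: ik; rewrite jk => /eqP;
      rewrite (negbTE ji).
  by apply: contrapT => e; apply: nZw; exists r, k.+1.
apply: esc; exists q; split=> //; split=> //.
apply/finite_set_natP; exists l => k /= Tk; rewrite ltnNge.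
by apply/negP => lk; exact: qT lk Tk.
Qed.

(** As [Z] is contained in its attractor [Y], the opponents can return to [Y] after each visit to
    [G], so [T] is visited again and again. *)
Lemma memoryless_punishment (n : nat) (V : Type) (A : arena n V)
    (s : profile A) (i : 'I_n) (T : set V) (v0 : V) :
  exists (Y : set V) (tau : V -> V),
  [/\ forall v, edge A v (tau v),
      forall v w, ctrl A i v -> Y v -> edge A v w -> Y w,
      forall q l, is_play A q -> Y (q l) ->
        (forall k, l <= k -> ~ ctrl A i (q k) -> q k.+1 = tau (q k)) ->
        ~ coBuchi A T q &
      (~ exists t : strategy A i, coBuchi A T (Out (dfwith s i t) v0)) ->
      forall l, Y (Out s v0 l)].
Proof.
pose Z := [set v | exists p l, [/\ is_play A p, p l = v
                                 & ~ escapes n V A s i T p l]].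
pose G := T `&` forced_next V (edge A) (ctrl A i) Z.
pose Y := attractor V (edge A) (ctrl A i) G.
have ZY : Z `<=` Y by exact: stuck_in_attractor.
have GY v : G v -> forced_next V (edge A) (ctrl A i) Y v.
  move=> [_ [iv niv]]; split=> [/iv vZ w /vZ|/niv[w vw /ZY Yw]]; first exact: ZY.
  by exists w.
have [f fY] := positional_attractor V (edge A) (ctrl A i) G.
(* At opponents' vertices, [tau] steps back into [Y] from [G] and follows the positional attractor
   strategy elsewhere. *)
have /choice[tau tauP] : forall v, exists w, edge A v w /\
    (~ ctrl A i v -> (G v -> Y w) /\ (~ G v -> edge A v (f v) -> w = f v)).
  move=> v; have [g gE] := choice (edge_total A).
  have [Gv|nGv] := pselect (G v).
    have [iv|niv] := pselect (ctrl A i v); first by exists (g v).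
    by have [_ /(_ niv)[w vw Yw]] := GY _ Gv; exists w.
  have [vf|nvf] := pselect (edge A v (f v)); first by exists (f v).
  by exists (g v).
exists Y, tau; split.
- by move=> v; case: (tauP v).
- move=> v w iv Yv vw; case: Yv iv vw => {}v.
  + by move=> /GY[Yv _] iv; exact: Yv.
  + by move=> _ Yv _; exact: Yv.
  + by move=> ? ? _ _ /[swap].
- move=> q l qE Yl qtau [_ /finite_set_natP[N TN]].
  have YG k : l <= k -> Y (q k) -> exists2 m, k <= m & G (q m).
    move=> lk /fY; apply: attracted_by_visits => [//|m km im nG fm].
    rewrite qtau ?(leq_trans lk)//.
    by case: (tauP (q m)) => _ /(_ im)[_]; exact.
  have GYS k : l <= k -> G (q k) -> Y (q k.+1).
    move=> lk Gk; have [ik|nik] := pselect (ctrl A i (q k)).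
      by case: (GY _ Gk) => /(_ ik) + _; apply; exact: qE.
    by rewrite qtau//; case: (tauP (q k)) => _ /(_ nik)[+ _]; exact.
  have Ginf k : exists2 m, k <= m & [/\ l <= m & G (q m)].
    elim: k => [|k [m km [lm Gm]]].
      by have [m lm Gm] := YG l (leqnn l) Yl; exists m.
    have [m' mm' Gm'] := YG m.+1 (leqW lm) (GYS _ lm Gm).
    exists m'; first exact: leq_ltn_trans km mm'.
    by split=> //; exact: leq_trans lm (ltnW mm').
  by have [m Nm [_ [/TN]]] := Ginf N; rewrite ltnNge Nm.
- move=> nowin l; apply: ZY; exists (Out s v0), l.
  have /OutP[pE p0 ps] : Out s v0 = Out s v0 by [].
  split=> // -[q [qT qp qs]]; apply: nowin.
  have [|j ji|t tq] := @deviation_outcome _ _ A s i q; first by case: qT.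
    move=> k jk; have [lk|kl] := leqP l k; first exact: qs.
    move: jk; rewrite !qp ?(ltnW kl)// => jk; rewrite (ps j)//.
    congr (strategy_fun _ _ _); apply/eq_in_map => x; rewrite mem_iota add0n.
    by move=> /andP[_ xk]; rewrite qp// ltnW// (ltn_trans xk).
  by exists t; rewrite -p0 -qp// tq.
Qed.

(** * Tails and simple paths *)

Lemma mem_SatPl (n : nat) (V : Type) (A : arena n V) (T : 'I_n -> set V)
    (p : nat -> V) (i : 'I_n) : is_play A p ->
  SatPl A T p i <-> exists N, forall k, N <= k -> ~ T i (p k).
Proof.
move=> pE; split=> [[_ /finite_set_natP[N pN]]|[N pN]].
  by exists N => k Nk /pN; rewrite ltnNge Nk.
split=> //; apply/finite_set_natP; exists N => k /= Tk; rewrite ltnNge.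
by apply/negP => /pN.
Qed.

Lemma SatPl_from (n : nat) (V : Type) (A : arena n V) (T : 'I_n -> set V)
    (p : nat -> V) : is_play A p ->
  exists N, forall i k, SatPl A T p i -> N <= k -> ~ T i (p k).
Proof.
move=> pE.
have /choice[N NP] : forall i, exists N, SatPl A T p i ->
    forall k, N <= k -> ~ T i (p k).
  move=> i; have [/(mem_SatPl _ _ _ _ _ _ pE)[N pN]|ni] := pselect (SatPl A T p i).
    by exists N.
  by exists 0.
exists (\max_i N i) => i k /NP iN Nk; apply: iN.
exact: leq_trans (leq_bigmax i) Nk.
Qed.

(* Removing a loop before time [N] makes the path into [Q] shorter. *)
Lemma simple_path (V : Type) (E : V -> V -> Prop) (R Q : set V)
    (p : nat -> V) (N0 : nat) :
  (forall l, E (p l) (p l.+1)) -> (forall l, R (p l)) ->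
  (forall l, N0 <= l -> Q (p l)) ->
  exists (r : nat -> V) (N : nat), r 0 = p 0 /\
    [/\ forall l, E (r l) (r l.+1), forall l, R (r l),
        forall l, N <= l -> Q (r l) & {in gtn N.+1 &, injective r}].
Proof.
move=> pE pR pQ.
pose path_in N := `[< exists r : nat -> V, r 0 = p 0 /\
  [/\ forall l, E (r l) (r l.+1), forall l, R (r l) &
      forall l, N <= l -> Q (r l)] >].
have [|N /asboolP[r [r0 [rE rR rQ]]] Nmin] := @ex_minnP path_in.
  by exists N0; apply/asboolP; exists p.
exists r, N; split=> //; split=> //.
have ninj a b : a < b -> b <= N -> r a <> r b.
  move=> ab bN rab; have : path_in (N - (b - a)).
    apply/asboolP; exists (fun l => if l < a then r l else r (l + (b - a))).
    split; last split.
    - case: a ab rab => [|a] // ab rab.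
      by rewrite ltnn add0n subn0 -rab.
    - move=> l; case: (ltngtP l.+1 a) => [la|al|la].
      + exact: rE.
      + by rewrite addSn.
      + by rewrite la subnKC ?(ltnW ab)// -rab -la.
    - by move=> l; case: ifP.
    - move=> l lN; have al : a <= l.
        apply: leq_trans lN.
        by rewrite leq_subRL ?(subnK (ltnW ab))// (leq_trans (leq_subr _ _)).
      by rewrite ltnNge al; apply: rQ; rewrite addnC -leq_subLR.
  move=> /Nmin; rewrite leqNgt; apply/negP; rewrite negbK.
  by rewrite ltn_subrL subn_gt0 ab (leq_trans _ bN)// (leq_ltn_trans _ ab).
move=> a b; rewrite !inE !ltnS => aN bN rab.
have [ab|ba|//] := ltngtP a b; first by have := ninj _ _ ab bN.
by have := ninj _ _ ba aN; rewrite rab.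
Qed.

(** * The Mealy machine *)

(* The machine follows [r] up to time [N] by counting, and from then on it only
   checks that the play stays in [Q], where it moves by [g], remembering the
   owner of the last vertex; the player who leaves this pattern is blamed and
   punished forever. *)
Lemma tracking_machine (n : nat) (V : Type) (A : arena n V) (R Q : set V)
    (r : nat -> V) (N : nat) (tau : 'I_n -> V -> V) :
  is_play A r -> (forall l, R (r l)) -> (forall l, N <= l -> Q (r l)) ->
  Q `<=` R -> (forall v, Q v -> exists2 w, edge A v w & Q w) ->
  (forall i v, edge A v (tau i v)) ->
  exists M : mealy V, [/\ #|mealy_state M| = N.+1 + 2 * n,
    forall (m : mealy_state M) v, edge A v (mealy_next m v) &
    forall q, q 0 = r 0 ->
      ((forall l, R (q l)) /\ (forall l, N <= l -> Q (q l))) \/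
      exists l, [/\ R (q l),
        q l.+1 <> mealy_next (mealy_run M (mkseq q l)) (q l) &
        forall k, l < k -> mealy_next (mealy_run M (mkseq q k)) (q k) =
          tau (owner A (q l)) (q k)]].
Proof.
move=> rE rR rQ QR QE tauE.
have /choice[g gP] : forall v, exists w, edge A v w /\ (Q v -> Q w).
  move=> v; have [/QE[w vw Qw]|nQ] := pselect (Q v); first by exists w.
  by have [w vw] := edge_total A v; exists w.
pose state : finType := ('I_N.+1 + ('I_n + 'I_n))%type.
pose accepts (m : state) v := match m with
  | inl a => v = r a | inr (inl _) => Q v | inr (inr _) => False end.
(* In state [inl a] the previous vertex is [r a.-1]. For [a = 0] the value is junk, but the first
   vertex is always accepted. *)
pose blame (m : state) := match m with
  | inl a => owner A (r a.-1) | inr (inl j) => j | inr (inr j) => j end.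
pose advance (m : state) v : state := match m with
  | inl a => if a < N then inl (inord a.+1) else inr (inl (owner A v))
  | inr _ => inr (inl (owner A v)) end.
pose follow (m : state) v := if m is inl a then r a.+1 else g v.
pose up m v := if `[< accepts m v >] then advance m v else inr (inr (blame m)).
pose next m v := if `[< accepts m v >] then follow m v else tau (blame m) v.
pose M := Mealy (inl ord0 : state) up next.
exists M; split.
- by rewrite /= !card_sum !card_ord mul2n addnn.
- move=> m v /=; rewrite /next; case: asboolP => [|_]; last exact: tauE.
  case: m => [a|[j|j]] //= => [->|Qv]; first exact: rE.
  by case: (gP v).
move=> q q0; pose st l := mealy_run M (mkseq q l).
have stS l : st l.+1 = up (st l) (q l).
  by rewrite /st mkseqS /mealy_run foldl_rcons.
pose expected l : state :=
  if l <= N then inl (inord l) else inr (inl (owner A (q l.-1))).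
have stE l : (forall k, k < l -> accepts (st k) (q k)) -> st l = expected l.
  elim: l => [|l IH] acc.
    by rewrite /st /expected /=; congr inl; apply/val_inj; rewrite /= inordK.
  have accl := acc _ (ltnSn l); rewrite stS /up asboolT//.
  rewrite IH => [|k kl]; last exact/acc/leqW.
  rewrite /expected /=; have [lN|Nl] := leqP l N; last first.
    by rewrite leqNgt (leqW Nl).
  by rewrite /= inordK ?ltnS//; case: ltnP.
have accE l : (forall k, k <= l -> accepts (st k) (q k)) ->
    if l <= N then q l = r l else Q (q l).
  move=> acc; have := acc l (leqnn l); rewrite stE => [|k /ltnW]; last exact: acc.
  by rewrite /expected; case: leqP => //= lN; rewrite inordK.
have accR l : (forall k, k <= l -> accepts (st k) (q k)) -> R (q l).
  by move=> /accE; case: leqP => // _; [move=> -> | exact: QR].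
have [acc|/existsNP[k0 nacc0]] := pselect (forall k, accepts (st k) (q k));
  [left|right].
  split=> l; first exact: accR.
  move=> Nl; have := accE l (fun k _ => acc k); case: leqP => // _ ->.
  exact: rQ.
have [|l /asboolP nacc lmin] := @ex_minnP (fun k => `[< ~ accepts (st k) (q k) >]).
  by exists k0; apply/asboolP.
have {lmin}acc k : k < l -> accepts (st k) (q k).
  by move=> kl; apply: contrapT => /asboolP/lmin; rewrite leqNgt kl.
case: l nacc acc => [|l] nacc acc; first by case: nacc; rewrite /= q0.
exists l; have accl := acc _ (ltnSn l).
have stl := stE l (fun k kl => acc k (leqW kl)).
have stlS := stE _ acc.
have blamel : blame (st l.+1) = owner A (q l).
  rewrite stlS /expected; case: ltnP => //= lN.
  by rewrite inordK ?ltnS//=; have := accE l acc; rewrite ltnW// => ->.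
split; first exact: accR.
- move=> qS; apply: nacc; rewrite qS -/(st l) /= /next asboolT//.
  rewrite stlS; move: accl; rewrite stl /expected.
  have [lN|Nl|lN] := ltngtP l N.
  + by rewrite /= !inordK ?ltnS// ltnW.
  + by rewrite /=; case: (gP (q l)).
  + by rewrite lN /= inordK// => _; exact: rQ.
(* The punishing state is entered only after reading the rejected [q l.+1], but [next] already
   punishes at that vertex. *)
- have punish k : st (l.+2 + k) = inr (inr (owner A (q l))).
    elim: k => [|k IH]; first by rewrite addn0 stS /up asboolF// blamel.
    by rewrite addnS stS IH /up asboolF.
  move=> k; rewrite leq_eqVlt => /orP[/eqP <-|lk].
    by rewrite -/(st l.+1) /= /next asboolF// blamel.
  by rewrite -(subnKC lk) -/(st _) punish /= /next asboolF.
Qed.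

(** * The maximal outcome and the equilibrium *)

(** At most [n] objectives can be satisfied, so a good play satisfying the most exists. Satisfying
    more leaves fewer losers and hence fewer constraints [Y i]. *)
Lemma maximal_satisfaction (n : nat) (V : Type) (A : arena n V)
    (T Y : 'I_n -> set V) (p0 : nat -> V) : is_play A p0 ->
  (forall i, ~ SatPl A T p0 i -> forall l, Y i (p0 l)) ->
  exists p : nat -> V, [/\ is_play A p, p 0 = p0 0,
    SatPl A T p0 `<=` SatPl A T p,
    forall i, ~ SatPl A T p i -> forall l, Y i (p l) &
    forall q, is_play A q -> q 0 = p0 0 -> SatPl A T p `<=` SatPl A T q ->
      (forall i, ~ SatPl A T p i -> forall l, Y i (q l)) ->
      SatPl A T q `<=` SatPl A T p].
Proof.
move=> p0E p0Y.
pose sat q := [pred i | `[< SatPl A T q i >]].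
pose good q := [/\ is_play A q, q 0 = p0 0, SatPl A T p0 `<=` SatPl A T q &
  forall i, ~ SatPl A T q i -> forall l, Y i (q l)].
have [|m /asboolP[q [_ <-]]|m /asboolP[p [[pE pp0 p0p pY] pm]] mmax] :=
    @ex_maxnP (fun m => `[< exists q, good q /\ #|sat q| = m >]) n.
- by exists #|sat p0|; apply/asboolP; exists p0; split=> //; split.
- by rewrite -[leqRHS]card_ord; exact: max_card.
exists p; split=> // q qE q0 pq qY i qi; apply: contrapT => npi.
have /mmax : `[< exists q', good q' /\ #|sat q'| = #|sat q| >].
  apply/asboolP; exists q; split=> //; split=> // [|j nqj].
    exact: subset_trans pq.
  by apply: qY; apply: contra_not nqj; exact: pq.
rewrite leqNgt -pm => /negP; apply; apply: proper_card; apply/properP; split.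
  by apply/fintype.subsetP => j /asboolP/pq jq; exact/asboolP.
by exists i; [exact/asboolP | apply/negP => /asboolP].
Qed.

Lemma nash_tracking (n : nat) (V : Type) (A : arena n V) (T : 'I_n -> set V)
    (v0 : V) (s' : profile A) :
  nash T s' v0 ->
  exists (s : profile A) (r : nat -> V) (N : nat),
    [/\ nash T s v0, forall i, memory_at_most (s i) (N.+1 + 2 * n),
        SatPl A T (Out s' v0) `<=` SatPl A T (Out s v0) &
        {in gtn N.+1 &, injective r}].
Proof.
move=> nash_s'.
have /OutP[p0E p00 _] : Out s' v0 = Out s' v0 by [].
have /choice[Y /choice[tau YP]] := fun i =>
  memoryless_punishment n V A s' i (T i) v0.
have Yp0 i : ~ SatPl A T (Out s' v0) i -> forall l, Y i (Out s' v0 l).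
  by move=> /nash_s'; case: (YP i).
have [p [pE p_0 p0p pY pmax]] := maximal_satisfaction _ _ _ T Y _ p0E Yp0.
have [N0 pN0] := SatPl_from _ _ _ T _ pE.
pose R := range p; pose Q := p @` [set l | N0 <= l].
have QR : Q `<=` R by move=> _ [l _ <-]; exists l.
have QE v : Q v -> exists2 w, edge A v w & Q w.
  move=> [l /= Nl <-]; exists (p l.+1) => //.
  by exists l.+1 => //=; exact: leqW.
(* By maximality of [p], the players that lose on [p] cannot win a play that
   stays in [R] and ends up in [Q], even by deviating. *)
have RQ_sat q N : is_play A q -> q 0 = v0 -> (forall l, R (q l)) ->
    (forall l, N <= l -> Q (q l)) -> SatPl A T q = SatPl A T p.
  move=> qE q0 qR qQ; have pq : SatPl A T p `<=` SatPl A T q.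
    move=> i ip; apply/mem_SatPl => //; exists N => l /qQ[k /= Nk <-].
    exact: pN0.
  apply/seteqP; split=> //; apply: pmax => //.
  by move=> i ip l; case: (qR l) => k _ <-; exact: pY.
have [||r [N [r0 [rE rR rQ rinj]]]] := simple_path _ (edge A) R Q p N0 pE.
- by move=> l; exists l.
- by move=> l Nl; exists l.
have [|M [Msize Medge MP]] :=
    tracking_machine _ _ A R Q r N tau rE rR rQ QR QE.
  by move=> i; case: (YP i).
(* One machine serves all players, as its update reads every vertex. *)
pose s : profile A := fun i => @Strategy _ _ A i
  (fun h v => mealy_next (mealy_run M h) v) (fun h v _ _ => Medge _ v).
have v0r : v0 = r 0 by rewrite r0 p_0 p00.
have Out_sat : SatPl A T (Out s v0) = SatPl A T p.
  have /OutP[oE o0 os] : Out s v0 = Out s v0 by [].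
  have [|[oR oQ]|[l [_ []]]] := MP (Out s v0); first by rewrite o0.
    exact: RQ_sat oQ.
  exact/os/ownerP.
exists s, r, N; split=> //; last first.
- by rewrite Out_sat.
- by move=> i; exists M => //; rewrite Msize.
move=> i; rewrite Out_sat => nip [t].
set q := Out _ _ => tq.
have /OutP[qE q0 qs] : q = Out (dfwith s i t) v0 by [].
have qnext l : owner A (q l) != i ->
    q l.+1 = mealy_next (mealy_run M (mkseq q l)) (q l).
  move=> ni; rewrite (qs (owner A (q l))); last exact/ownerP.
  by rewrite dfwithout// eq_sym.
have [|[qR qQ]|[l [[k _ pkl] qdev qtau]]] := MP q; first by rewrite q0.
  by apply: nip; rewrite -(RQ_sat q N).
(* Only [i] departs from the machine, so the blame is correct. *)
have il : owner A (q l) = i.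
  by apply/eqP; apply: contrapT => /negP/qnext.
have [_ Ystep Ywin _] := YP i.
(* The deviation starts at a vertex of [p], hence in [Y i], which no move of [i] leaves; punishment
   thus succeeds from [l.+1] on. *)
apply: (Ywin q l.+1 qE _ _ tq).
  apply: (Ystep (q l)) => //; first exact/ownerP.
  by rewrite -pkl; exact: pY.
move=> m lm /ownerP/eqP im.
by rewrite qnext// qtau// il.
Qed.

Theorem theorem47 (n : nat) (n_ge1 : (1 <= n)%N) (V : Type) (A : arena n V)
    (T : 'I_n -> set V) (v0 : V) (s' : profile A) :
  nash T s' v0 ->
  (exists s : profile A,
     [/\ nash T s v0, finite_memory_profile s &
         SatPl A T (Out s' v0) `<=` SatPl A T (Out s v0)]) /\
  (forall k : nat, [set: V] #= `I_k ->
   exists s : profile A,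
     [/\ nash T s v0, forall i, memory_at_most (s i) (k + 2 * n)%N &
         SatPl A T (Out s' v0) `<=` SatPl A T (Out s v0)]).
Proof.
move=> /(nash_tracking _ _ _ _ _ _)[s [r [N [nash_s mem_s sat_s rinj]]]]; split.
  exists s; split=> // i; have [M _ MP] := mem_s i.
  by exists M.
move=> k Vk; exists s; split=> // i.
(* The simple path has [N.+1] distinct vertices among the [k] of the arena. *)
have Nk : N.+1 <= k.
  have /card_set_bijP[f [fk finj _]] := Vk.
  have fr (a : 'I_N.+1) : f (r a) < k by exact: (fk (r a)).
  rewrite -[N.+1]card_ord -[k]card_ord.
  apply: (@leq_card _ _ (fun a => Ordinal (fr a))) => a b [] fab.
  apply/val_inj/rinj; [exact: ltn_ord..|].
  by apply: finj fab; rewrite inE.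
have [M Mle MP] := mem_s i; exists M => //.
by apply: leq_trans Mle _; rewrite leq_add2r.
Qed.
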